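(* For every hypergraph $\mathcal{H}$, the game fractional transversal numbers for the Staller-start and for the Edge-hitter-start games on $\mathcal{H}$ differ by at most $1$, that is, $|\tau_g^*(\mathcal{H})-{\tau_g^*}'(\mathcal{H})|\le1$.
   Context: A hypergraph $\mathcal{H}=(V,\mathcal{E})$ has a finite vertex set $V$ and an edge set $\mathcal{E}\subseteq 2^V\setminus\{\emptyset\}$. Fractional transversal game on $\mathcal{H}$: Edge-hitter and Staller take turns making moves and update a cover function $t:V\to[0,1]$, with $|t|=\sum_{v}t(v)$. The corresponding load function is $\ell:\mathcal{E}\to[0,1]$, $\ell(E)=\min\{1,\sum_{v\in E}t(v)\}$. The functions after the $i$-th move are $t_i,\ell_i$; initially $t_0\equiv0$, $\ell_0\equiv0$. The game is finished when $\ell\equiv1$. As long as $\ell\not\equiv1$, the next player performs a move, which is a finite or infinite sequence of submoves $(u_1,w_1),(u_2,w_2),\dots$, where $u_k\in V$ (repetitions allowed) and $w_k\in[0,1]$. It is required that $\sum_kw_k=1$ in each move except the last move of the game, where $\sum_kw_k\le1$ suffices. The $i$-th move must be legal: for every $k\ge1$ there is an edge $E\in\mathcal{E}$ with $u_k\in E$ and $\ell_{i-1}(E)+\sum_{1\le s\le k-1,\,u_s\in E}w_s+w_k\le1$. The function $t_i$ is obtained from $t_{i-1}$ by adding $w_k$ to the value at $u_k$ for every submove. The value $|\mathcal{G}|$ of a game is $|t_q|$ for the final cover function $t_q$. Edge-hitter wants it small, Staller wants it large. $\tau_g^*(\mathcal{H})$ is the infimum of all $a$ such that Edge-hitter has a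 strategy ensuring $|\mathcal{G}|\le a$ when Edge-hitter starts; ${\tau_g^*}'(\mathcal{H})$ is defined in the same way for the game in which Staller makes the first move. *)

(* Defs.v *)
From mathcomp Require Import all_boot all_order all_algebra.
From mathcomp Require Import all_classical all_reals all_analysis.

Set Implicit Arguments.
Unset Strict Implicit.
Unset Printing Implicit Defensive.

Import Order.TTheory GRing.Theory Num.Theory.
Local Open Scope ring_scope.

Record hypergraph (V : finType) := Hypergraph {
  edges : {set {set V}};
  edges_nonempty : finset.set0 \notin edges }.

Inductive player := EdgeHitter | Staller.

Definition opponent (p : player) : player :=
  match p with EdgeHitter => Staller | Staller => EdgeHitter end.

Section Game.
Context {R : realType} {V : finType} (H : hypergraph V).

(* A cover function. No bound is built into the type: legality of the moves
   keeps the values reached from 0 inside [0, 1]. *)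
Definition cover := {ffun V -> R}.

Definition cover_size (t : cover) : R := \sum_v t v.

Definition load (t : cover) (E : {set V}) : R :=
  Num.min 1 (\sum_(v in E) t v).

Definition finished (t : cover) : Prop :=
  forall E, E \in edges H -> load t E = 1.

Inductive move :=
  | FinMove of seq (V * R)
  | InfMove of (nat -> V * R).

(* Submoves are numbered from 0; [None] lies beyond the end of a finite move. *)
Definition submove (m : move) (k : nat) : option (V * R) :=
  match m with
  | FinMove s => onth s k
  | InfMove f => Some (f k)
  end.

Definition weight_on (m : move) (A : {set V}) (k : nat) : R :=
  if submove m k is Some (u, w) then (if u \in A then w else 0) else 0.

(* Computed in the extended reals, so that a divergent sequence of nonnegative
   weights has total +oo instead of a default value. *)
Definition total_on (m : move) (A : {set V}) : \bar R :=
  (\sum_(0 <= k <oo) (weight_on m A k)%:E)%E.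

Definition update (t : cover) (m : move) : cover :=
  [ffun v => t v + fine (total_on m [set v])].

Definition legal (t : cover) (m : move) : Prop :=
  forall k u w, submove m k = Some (u, w) ->
    (0 <= w <= 1) /\
    exists E, [/\ E \in edges H, u \in E &
      load t E + \sum_(s < k) weight_on m E s + w <= 1].

(* A move of total weight less than 1 is only possible if it ends the game. *)
Definition admissible (t : cover) (m : move) : Prop :=
  legal t m /\
  (total_on m [set: V] = 1%E \/
   (total_on m [set: V] <= 1)%E /\ finished (update t m)).

(* Histories list the moves in chronological order. *)
Definition history := seq move.

Definition position (h : history) : cover := foldl update [ffun=> 0] h.

Inductive play : history -> Prop :=
  | play_start : play [::]
  | play_move h m : play h -> ~ finished (position h) ->
      admissible (position h) m -> play (rcons h m).

Definition to_move (first : player) (h : history) : player :=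
  iter (size h) opponent first.

Definition strategy := history -> move.

Definition follows (first : player) (sigma : strategy) (h : history) : Prop :=
  forall h1 m h2, h = h1 ++ m :: h2 ->
    to_move first h1 = EdgeHitter -> m = sigma h1.

Definition valid_strategy (first : player) (sigma : strategy) : Prop :=
  forall h, play h -> follows first sigma h -> ~ finished (position h) ->
    to_move first h = EdgeHitter -> admissible (position h) (sigma h).

(* Quantifying over finished plays covers every game: each move except the
   last adds 1 to the size of the cover function, which never exceeds #|V|,
   so there is no infinite play. *)
Definition ensures (first : player) (sigma : strategy) (a : R) : Prop :=
  forall h, play h -> follows first sigma h -> finished (position h) ->
    cover_size (position h) <= a.

End Game.

Section GameNumbers.
Context (R : realType) {V : finType} (H : hypergraph V).

Definition game_number (first : player) : R :=
  inf [set a : R | exists sigma : @strategy R V,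
    valid_strategy H first sigma /\ ensures H first sigma a]%classic.

Definition tau_g : R := game_number EdgeHitter.

Definition tau_g' : R := game_number Staller.

End GameNumbers.

(* Main.v *)
Require Import Defs.
From mathcomp Require Import all_boot all_order all_algebra.
From mathcomp Require Import all_classical all_reals all_analysis.
From mathcomp Require Import lra.

Set Implicit Arguments.
Unset Strict Implicit.
Unset Printing Implicit Defensive.

Import Order.TTheory GRing.Theory Num.Theory.
Local Open Scope ring_scope.

(** The theorem is a consequence of a fractional continuation principle:
    raising the loads of a position cannot hurt Edge-hitter, as far as the
    weight still to be played is concerned.  Suppose that Edge-hitter can keep
    the game below [a] when player [p] starts.  Let the opponent of [p] start
    instead.  After the first move, which has total weight at most 1, player [p]
    is to move at a position whose loads are at least those of the initial one,
    so Edge-hitter can keep the game below [a + 1].  Applied to both players,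
    this gives the two inequalities (lemma [game_number_opponent]).

    The continuation principle is proved by imagination.  Edge-hitter follows a
    good strategy in an imagined game whose loads are dominated by those of the
    real game ([dominates]).  A move of Staller in the real game is copied into
    the imagined one, where it is legal because the loads are smaller
    ([turn_copy]).  A move of Edge-hitter in the imagined game is transferred to
    the real one by cutting every submove off at the largest legal weight; when
    a weight is reduced, all edges at that vertex become saturated, so domination
    survives.  Any weight that is saved in this way is spent greedily
    ([turn_cutoff], with [fill]).  In both cases the real game grows by no more
    than the imagined one.

    Moves that are infinite sequences would obstruct this argument, since nothing
    can be appended to them.  But every legal move of total weight at most 1 has the
    effect of a finite one ([reach_update]): from some submove on, weight is put only on vertices
    that lie in an edge whose final raw load is at most 1, and the missing
    weight of these vertices can be added in one submove per vertex, in any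
    order.  The game is therefore analysed through the relation [reach] between
    covers, and strategies are replaced by the inductive predicate [winning]. *)

Local Notation total_on := Defs.total_on.

Section FractionalGame.
Context {R : realType} {V : finType} (H : hypergraph V).

Implicit Types (t s : @Defs.cover R V) (u v : V) (w : R) (A E F : {set V}).
Implicit Types (p : player).

(** * Covers reached by finitely many submoves *)

Definition mass t A : R := \sum_(v in A) t v.

Definition raise t u w : @Defs.cover R V :=
  [ffun v => t v + (if v == u then w else 0)].

(** [reach] uses raw loads instead of loads truncated at 1: for a submove of
    positive weight the two conditions agree, and a submove of weight 0 has no
    effect on the cover. *)
Inductive reach t : @Defs.cover R V -> Prop :=
| reach_refl : reach t t
| reach_step t' u w E : reach t t' -> 0 < w -> E \in edges H -> u \in E ->
    mass t' E + w <= 1 -> reach t (raise t' u w).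

Lemma mass_raise t u w A :
  mass (raise t u w) A = mass t A + (if u \in A then w else 0).
Proof.
rewrite /mass /raise; under eq_bigr do rewrite ffunE.
rewrite big_split /=; congr (_ + _).
rewrite -big_mkcondr /=; case: ifP => uA.
  by rewrite (eq_bigl (pred1 u)) ?big_pred1_eq // => v; rewrite andb_idl // => /eqP->.
by rewrite big_pred0 // => v; apply/negP => /andP[vA /eqP vu]; rewrite -vu vA in uA.
Qed.

Lemma mass_size t : mass t [set: V]%SET = cover_size t.
Proof. by apply: eq_bigl => v; rewrite finset.in_setT. Qed.

Lemma mass_set1 t v : mass t [set v]%SET = t v.
Proof. exact: big_set1. Qed.

Lemma size_raise t u w : cover_size (raise t u w) = cover_size t + w.
Proof. by rewrite -!mass_size mass_raise finset.in_setT. Qed.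

Lemma mass_mono t s A : (forall v, t v <= s v) -> mass t A <= mass s A.
Proof. by move=> ts; exact: ler_sum. Qed.

Lemma le_mass t E v : (forall v, 0 <= t v) -> v \in E -> t v <= mass t E.
Proof. by move=> t0 vE; rewrite /mass (bigD1 v) //= lerDl sumr_ge0. Qed.

Lemma finishedP t : finished H t <-> forall E, E \in edges H -> 1 <= mass t E.
Proof.
split=> fin E EH; first by rewrite -(fin E EH) /load ge_min lexx orbT.
by rewrite /load min_l // fin.
Qed.

Lemma unfinished_edge t : ~ finished H t -> exists2 E, E \in edges H & mass t E < 1.
Proof.
move=> nfin; apply: contrapT => none; apply/nfin/finishedP => E EH.
by rewrite leNgt; apply/negP => lt; apply: none; exists E.
Qed.

Lemma raise_ge t u w v : 0 <= w -> t v <= raise t u w v.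
Proof. by move=> w0; rewrite ffunE lerDl; case: ifP. Qed.

Lemma reach_trans t t1 t2 : reach t t1 -> reach t1 t2 -> reach t t2.
Proof. by move=> r; elim=> // t' u w E _; exact: reach_step. Qed.

Lemma reach_raise t u w E : 0 < w -> E \in edges H -> u \in E ->
  mass t E + w <= 1 -> reach t (raise t u w).
Proof. by move=> *; apply: (@reach_step _ _ _ _ E) => //; exact: reach_refl. Qed.

Lemma reach_ge t t' : reach t t' -> forall v, t v <= t' v.
Proof.
by elim=> [v|t1 u w E _ IH w0 _ _ _ v] //; apply: le_trans (IH v) (raise_ge _ _ _ (ltW w0)).
Qed.

(** The edge that makes a submove at [u] legal contains [u], so the new value at
    [u] is bounded by the new raw load of that edge. *)
Lemma reach_range t t' : (forall v, 0 <= t v <= 1) -> reach t t' ->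
  forall v, 0 <= t' v <= 1.
Proof.
move=> t01; elim=> // t1 u w E _ IH w0 EH uE le1 v.
have t10 v' : 0 <= t1 v' by case/andP: (IH v').
have := le_mass t10 uE; have := IH v; rewrite ffunE; case: eqP => [->|_]; lra.
Qed.

(** If each vertex that must grow lies in an edge whose raw load is at most 1
    in the target cover, that edge has enough room at all times before, and the
    vertices can be raised one after the other in any order. *)
Lemma reach_between t t' : (forall v, t v <= t' v) ->
  (forall v, t v < t' v -> exists E, [/\ E \in edges H, v \in E & mass t' E <= 1]) ->
  reach t t'.
Proof.
have [n] := ubnP #|[pred v | t v < t' v]|; elim: n t => // n IH t.
rewrite ltnS => card_le le_tt' room.
have [[v lt_v]|none] := pselect (exists v, t v < t' v); last first.
  suff -> : t' = t by exact: reach_refl.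
  apply/ffunP => v; apply/eqP; rewrite eq_le le_tt' andbT leNgt.
  by apply/negP => lt_v; apply: none; exists v.
have [E [EH vE mE]] := room v lt_v.
pose t1 := raise t v (t' v - t v).
have t1E v' : t1 v' = if v' == v then t' v else t v'.
  by rewrite ffunE; case: eqP => [->|_]; lra.
have le_t1 v' : t1 v' <= t' v' by rewrite t1E; case: eqP => [->|_].
apply: (@reach_trans _ t1).
  apply: (@reach_raise _ _ _ E) => //; first by rewrite subr_gt0.
  by have := mass_mono E le_t1; rewrite mass_raise vE; lra.
apply: IH => //.
  apply: leq_trans card_le; apply/proper_card/properP; split.
    by apply/fintype.subsetP => v'; rewrite !inE t1E; case: eqP => // ->; rewrite ltxx.
  by exists v; rewrite !inE ?t1E ?eqxx ?ltxx.
by move=> v'; rewrite t1E; case: eqP => [->|_]; rewrite ?ltxx //; exact: room.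
Qed.

(** Greedy play: as long as some edge is unsaturated, put on one of its vertices
    the weight that saturates it, or all the remaining weight.  Every submove but
    the last one saturates a new edge. *)
Lemma fill t c : 0 <= c -> exists2 t', reach t t' &
  cover_size t' = cover_size t + c \/
  cover_size t' <= cover_size t + c /\ finished H t'.
Proof.
have [n] := ubnP #|[pred E | (E \in edges H) && (mass t E < 1)]|.
elim: n t c => // n IH t c; rewrite ltnS => card_le.
rewrite le_eqVlt => /predU1P[<-|c0].
  by exists t; [exact: reach_refl|left; rewrite addr0].
have [fin|/unfinished_edge[E EH mE]] := pselect (finished H t).
  by exists t; [exact: reach_refl|right; split=> //; lra].
have [u uE] : exists u, u \in E.
  apply/finset.set0Pn; apply: contraTneq EH => ->; exact: edges_nonempty.
have [le_c|lt_c] := leP c (1 - mass t E).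
  exists (raise t u c); last by left; rewrite size_raise.
  by apply: (@reach_raise _ _ _ E) => //; lra.
pose w := 1 - mass t E; have w0 : 0 < w by rewrite subr_gt0.
have r1 : reach t (raise t u w) by apply: (@reach_raise _ _ _ E) => //; rewrite /w; lra.
have [||t' r' end'] := IH (raise t u w) (c - w).
- apply: leq_trans card_le; apply/proper_card/properP; split.
    apply/fintype.subsetP => F; rewrite !inE => /andP[-> /=]; apply: le_lt_trans.
    by apply: mass_mono => v; exact: raise_ge (ltW w0).
  by exists E; rewrite !inE EH ?mE //= mass_raise uE /w -leNgt; lra.
- by rewrite /w; lra.
exists t'; first exact: reach_trans r1 r'.
by move: end'; rewrite size_raise => -[|[]] h; [left|right; split=> //]; lra.
Qed.

(** * Turns *)

Definition turn t t' : Prop :=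
  reach t t' /\ (cover_size t' = cover_size t + 1 \/
                 cover_size t' <= cover_size t + 1 /\ finished H t').

Lemma turn_exists t : exists t', turn t t'.
Proof. by have [t' r e] := fill t ler01; exists t'. Qed.

Lemma turn_size t t' : turn t t' -> cover_size t <= cover_size t' <= cover_size t + 1.
Proof.
move=> [/reach_ge/(mass_mono [set: V]%SET)]; rewrite !mass_size => -> /=.
by case=> [->|[]].
Qed.

Definition continues t' t : Prop := ~ finished H t /\ turn t t'.

(** A turn that leaves the game unfinished adds exactly 1 to the size of a cover
    whose values stay in [0, 1], so the game ends after at most #|V| such turns. *)
Lemma turn_wf t : (forall v, 0 <= t v <= 1) ->
  Acc continues t.
Proof.
have [n] : exists n : nat, #|V|%:R < cover_size t + n%:R.
  exists (Num.truncn (#|V|%:R - cover_size t)).+1.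
  by rewrite -ltrBlDl truncnS_gt.
elim: n t => [|n IH] t.
  rewrite addr0 => lt_t t01; exfalso; move: lt_t; apply/negP; rewrite -leNgt.
  by rewrite -sum1_card natr_sum; apply: ler_sum => v _; case/andP: (t01 v).
move=> lt_t t01; constructor => t' [_ [r size_t']].
have [fin|nfin] := pselect (finished H t'); first by constructor => ? [].
case: size_t' => [size_t'|[]//]; apply: IH; last exact: reach_range r.
by rewrite size_t'; move: lt_t; rewrite -natr1; lra.
Qed.

(** * Simulation of a position by one with smaller loads *)

(** This is the inequality between the truncated loads of [t] and [s]: nothing is
    required on an edge that is saturated in [s]. *)
Definition dominates s t : Prop :=
  forall E, E \in edges H -> mass s E < 1 -> mass t E <= mass s E.

Lemma dominates_finished s t : dominates s t -> finished H t -> finished H s.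
Proof.
move=> dom /finishedP fin; apply/finishedP => E EH.
by rewrite leNgt; apply/negP => lt1; have := dom E EH lt1; have := fin E EH; lra.
Qed.

Lemma dominates_reach s t s' : dominates s t -> reach s s' -> dominates s' t.
Proof.
move=> dom /reach_ge ge E EH lt1; have le := mass_mono E ge.
exact: le_trans (dom E EH (le_lt_trans le lt1)) le.
Qed.

Lemma finished_dominates s t : finished H s -> dominates s t.
Proof. by move=> /finishedP fin E EH; rewrite ltNge fin. Qed.

(** A submove of positive weight is legal in [s] because of an edge that is not
    saturated there, hence has a load in [t] that is not larger. *)
Lemma reach_copy s t s' : dominates s t -> reach s s' ->
  exists2 t', reach t t' /\ dominates s' t' &
    cover_size t' - cover_size t = cover_size s' - cover_size s.
Proof.
move=> dom; elim=> [|s1 u w E _ [t1 [r1 dom1] eq1] w0 EH uE le1].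
  by exists t; [split=> //; exact: reach_refl|lra].
exists (raise t1 u w); last by rewrite !size_raise; lra.
split.
  by apply: (reach_step r1 w0 EH uE); have := dom1 E EH; lra.
move=> F FH; rewrite !mass_raise => ltF; have := dom1 F FH.
by move: ltF; case: ifP; lra.
Qed.

(** A submove of weight [w] at [u] is cut off at [1 - mass s1 F], where [F] has
    the smallest raw load among the edges at [u], and dropped if this is not
    positive.  Either the weight is unchanged, or all the edges at [u] are
    saturated afterwards, and on these domination requires nothing. *)
Lemma reach_cutoff s t t' : dominates s t -> reach t t' ->
  exists2 s', reach s s' /\ dominates s' t' &
    cover_size s' - cover_size s <= cover_size t' - cover_size t.
Proof.
move=> dom; elim=> [|t1 u w E _ [s1 [r1 dom1] le_s1] w0 EH uE le1].
  by exists s; [split=> //; exact: reach_refl|lra].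
pose at_u := [pred G | (G \in edges H) && (u \in G)].
have E0 : at_u E by rewrite /= EH.
case: (arg_minP (mass s1) E0) => F /andP[FH uF] minF.
have {}minF G : G \in edges H -> u \in G -> mass s1 F <= mass s1 G.
  by move=> GH uG; apply/minF/andP.
have [full|room] := leP 1 (mass s1 F).
  exists s1; last by rewrite size_raise; lra.
  split=> // G GH ltG; rewrite mass_raise; have := dom1 G GH ltG.
  by case: ifP => [uG|_]; [have := minF G GH uG|]; lra.
have [le_w|lt_w] := leP w (1 - mass s1 F).
  exists (raise s1 u w); last by rewrite !size_raise; lra.
  split; first by apply: (reach_step r1 w0 FH uF); lra.
  move=> G GH; rewrite !mass_raise => ltG; have := dom1 G GH.
  by move: ltG; case: ifP; lra.
exists (raise s1 u (1 - mass s1 F)); last by rewrite !size_raise; lra.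
split; first by apply: (reach_step r1 _ FH uF); lra.
move=> G GH; rewrite !mass_raise; have := dom1 G GH.
by case: ifP => [uG|_]; [have := minF G GH uG|]; lra.
Qed.

(** The last move of the game on [s] may have total weight less than 1 while the
    game on [t] is not finished; the copy is then completed to a full turn, and
    domination holds because [s'] is finished. *)
Lemma turn_copy s t s' : dominates s t -> turn s s' ->
  exists t', [/\ turn t t', dominates s' t' &
    cover_size s' - cover_size s <= cover_size t' - cover_size t].
Proof.
move=> dom trn; have [_ le1] := andP (turn_size trn).
have [r size_s'] := trn; have [t1 [r1 dom1] eq1] := reach_copy dom r.
case: size_s' => [size_s'|[_ fin]].
  by exists t1; split=> //; [split=> //; left|]; lra.
have [|t' r' size_t'] := @fill t1 (1 - (cover_size t1 - cover_size t)).
  by lra.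
exists t'; split.
- by split; [exact: reach_trans r1 r'|case: size_t' => [|[]] ?; [left|right; split=> //]; lra].
- exact: finished_dominates.
- by have := mass_mono [set: V]%SET (reach_ge r'); rewrite !mass_size; lra.
Qed.

(** The weight lost by the cutoff is spent by [fill], which only increases the
    loads on the dominating side. *)
Lemma turn_cutoff s t t' : dominates s t -> turn t t' ->
  exists s', [/\ turn s s', dominates s' t' &
    cover_size s' - cover_size s <= cover_size t' - cover_size t].
Proof.
move=> dom [r size_t']; have [s1 [r1 dom1] le1] := reach_cutoff dom r.
case: size_t' => [size_t'|[size_t' fin]]; last first.
  exists s1; split=> //; split=> //; right; split; first lra.
  exact: dominates_finished dom1 fin.
have [|s' r' size_s'] := @fill s1 (1 - (cover_size s1 - cover_size s)).
  by lra.
exists s'; split.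
- by split; [exact: reach_trans r1 r'|case: size_s' => [|[]] ?; [left|right; split=> //]; lra].
- exact: dominates_reach r'.
- by case: size_s' => [|[]] ?; lra.
Qed.

(** * Positions from which Edge-hitter can keep the final size small *)

(** [winning a p t]: Edge-hitter can force the final size, which includes the
    weight already present in [t], to be at most [a] when [p] is to move.  Being
    inductive, it contains the termination of the game. *)
Inductive winning (a : R) : player -> @Defs.cover R V -> Prop :=
| winning_finished p t : finished H t -> cover_size t <= a -> winning a p t
| winning_hitter t t' : ~ finished H t -> turn t t' ->
    winning a Staller t' -> winning a EdgeHitter t
| winning_staller t : ~ finished H t ->
    (forall t', turn t t' -> winning a EdgeHitter t') -> winning a Staller t.

Lemma winning_size a p t : winning a p t -> cover_size t <= a.
Proof.
elim=> {p t} // [t t' _ trn _|t _ _ IH].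
  by apply: le_trans; case/andP: (turn_size trn).
have [t' trn] := turn_exists t; apply: le_trans (IH _ trn).
by case/andP: (turn_size trn).
Qed.

(** The continuation principle.  The hypothesis on sizes says that the weight
    still allowed, [b - cover_size s], is at least [a - cover_size t]; it is
    preserved since the game on [s] grows no faster than the one on [t]. *)
Lemma continuation a b p s t : winning a p t -> dominates s t ->
  cover_size s - cover_size t <= b - a -> winning b p s.
Proof.
move=> win; elim: win s => {p t}
  [p t fin le_a|t t' nfin trn win IH|t nfin win IH] s dom le_b.
- by apply: winning_finished; [exact: dominates_finished fin|lra].
- have [sfin|snfin] := pselect (finished H s).
    apply: winning_finished => //; have := winning_size win.
    by have := turn_size trn; lra.
  have [s' [trn' dom' le']] := turn_cutoff dom trn.
  by apply: winning_hitter trn' _ => //; apply: IH => //; lra.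
- have [sfin|snfin] := pselect (finished H s).
    apply: winning_finished => //.
    by have := winning_size (winning_staller nfin win); lra.
  apply: winning_staller => // s' trn.
  have [t' [trn' dom' le']] := turn_copy dom trn.
  by apply: IH trn' _ dom' _; lra.
Qed.

(** After any first turn of the opponent, the continuation principle compares
    the position reached with the initial one. *)
Lemma winning_opponent a p : winning a p [ffun=> 0] ->
  winning (a + 1) (opponent p) [ffun=> 0].
Proof.
set z : Defs.cover := [ffun=> 0] => win.
have skip t' : turn z t' -> winning (a + 1) p t'.
  move=> trn; apply: (continuation win); last by have := turn_size trn; lra.
  by apply: (dominates_reach _ (proj1 trn)) => E.
have [fin|nfin] := pselect (finished H z).
  by apply: winning_finished fin _; have := winning_size win; lra.
case: p win skip => win skip /=; first exact: winning_staller.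
have [t' trn] := turn_exists z.
by apply: (winning_hitter nfin trn); exact: skip.
Qed.

(** Any play of Edge-hitter is good for the trivial bound. *)
Lemma winning_card p t : (forall v, 0 <= t v <= 1) -> winning #|V|%:R p t.
Proof.
move=> t01; have acc := turn_wf t01; elim: acc p t01 => {}t _ IH p t01.
have [fin|nfin] := pselect (finished H t).
  apply: winning_finished => //.
  by rewrite -sum1_card natr_sum; apply: ler_sum => v _; case/andP: (t01 v).
have next t' q : turn t t' -> winning #|V|%:R q t'.
  by move=> trn; apply: IH => //; exact: reach_range (proj1 trn).
case: p; last by apply: winning_staller => // t' /next.
by have [t' trn] := turn_exists t; apply: (winning_hitter nfin trn); exact: next.
Qed.

(** * Moves as turns *)

Implicit Types (m : @move R V).

Definition partial m A k : R := \sum_(i < k) weight_on m A i.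

Definition cover_after t m k : @Defs.cover R V :=
  [ffun v => t v + partial m [set v]%SET k].

Lemma weight_on_ge0 t m A k : legal H t m -> 0 <= weight_on m A k.
Proof.
rewrite /weight_on => leg; case sub: (submove m k) => [[u w]|] //.
by case: ifP => // _; have [/andP[]] := leg _ _ _ sub.
Qed.

Lemma weight_on_sum m A k : weight_on m A k = \sum_(v in A) weight_on m [set v]%SET k.
Proof.
rewrite /weight_on; case: (submove m k) => [[u w]|]; last by rewrite big1.
under eq_bigr => v _ do rewrite finset.in_set1.
rewrite -big_mkcondr /=; case: ifP => uA.
  rewrite (eq_bigl (pred1 u)) ?big_pred1_eq // => v /=.
  by rewrite (eq_sym u); apply: andb_idl => /eqP->.
by rewrite big_pred0 // => v; apply/negP => /andP[vA /eqP vu]; rewrite vu vA in uA.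
Qed.

Lemma mass_after t m A k : mass (cover_after t m k) A = mass t A + partial m A k.
Proof.
rewrite /mass; under eq_bigr do rewrite ffunE.
rewrite big_split /=; congr (_ + _).
by rewrite exchange_big /=; apply: eq_bigr => i _; rewrite -weight_on_sum.
Qed.

Lemma partialS m A k : partial m A k.+1 = partial m A k + weight_on m A k.
Proof. exact: big_ord_recr. Qed.

Lemma cover_afterS t m k u w : submove m k = Some (u, w) ->
  cover_after t m k.+1 = raise (cover_after t m k) u w.
Proof.
move=> sub; apply/ffunP => v; rewrite !ffunE partialS /weight_on sub addrA.
by rewrite finset.in_set1 eq_sym.
Qed.

Lemma cover_afterS_none t m k : submove m k = None ->
  cover_after t m k.+1 = cover_after t m k.
Proof.
by move=> sub; apply/ffunP => v; rewrite !ffunE partialS /weight_on sub addr0.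
Qed.

Lemma cover_after0 t m : cover_after t m 0 = t.
Proof. by apply/ffunP => v; rewrite ffunE /partial big_ord0 addr0. Qed.

Lemma legal_edge t m k u w : legal H t m -> submove m k = Some (u, w) -> 0 < w ->
  exists E, [/\ E \in edges H, u \in E & mass (cover_after t m k) E + w <= 1].
Proof.
move=> leg sub w0; have [_ [E [EH uE le1]]] := leg _ _ _ sub.
exists E; split=> //; rewrite mass_after.
have P0 : 0 <= partial m E k by apply: sumr_ge0 => i _; exact: weight_on_ge0 leg.
move: le1; rewrite /load -/(mass t E) -/(partial m E k) minElt.
by case: ifP => _; lra.
Qed.

Lemma reach_after t m k : legal H t m -> reach t (cover_after t m k).
Proof.
move=> leg; elim: k => [|k IH]; first by rewrite cover_after0; exact: reach_refl.
case sub: (submove m k) => [[u w]|]; last by rewrite cover_afterS_none.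
rewrite (cover_afterS _ sub); have [/andP[]] := leg _ _ _ sub.
rewrite le_eqVlt => /predU1P[<- _ _|w0 _ _].
  suff -> : raise (cover_after t m k) u 0 = cover_after t m k by [].
  by apply/ffunP => v; rewrite ffunE if_same addr0.
have [E [EH uE le1]] := legal_edge leg sub w0.
exact: reach_step IH w0 EH uE le1.
Qed.

Section LegalMove.
Context t m (leg : legal H t m) (tot1 : (total_on m [set: V]%SET <= 1)%E).

Let total A : R := fine (total_on m A).

Lemma total_onE A : total_on m A = (total A)%:E.
Proof.
rewrite /total fineK // ge0_fin_numE; last first.
  by apply: nneseries_ge0 => k _ _; rewrite lee_fin (weight_on_ge0 _ _ leg).
apply: le_lt_trans (le_trans _ tot1) (ltry 1).
apply: lee_nneseries => k; first by rewrite lee_fin (weight_on_ge0 _ _ leg).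
rewrite lee_fin /weight_on; case sub: (submove m _) => [[u w]|] //.
rewrite finset.in_setT; case: ifP => // _.
by have [/andP[]] := leg sub.
Qed.

Lemma partial_le A k : partial m A k <= total A.
Proof.
rewrite -lee_fin -total_onE /partial -sumEFin.
rewrite -(big_mkord xpredT (fun i => (weight_on m A i)%:E)).
by apply: nneseries_lim_ge => i _ _; rewrite lee_fin (weight_on_ge0 _ _ leg).
Qed.

Lemma partial_lim A x : x < total A -> exists k, x < partial m A k.
Proof.
move=> lt_x; apply: contrapT => none; move: lt_x; apply/negP; rewrite -leNgt.
rewrite -lee_fin -total_onE; apply: lime_le.
  by apply: is_cvg_nneseries => k _ _; rewrite lee_fin (weight_on_ge0 _ _ leg).
apply: nearW => k; rewrite big_mkord sumEFin lee_fin leNgt; apply/negP => lt_k.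
by apply: none; exists k.
Qed.

Lemma total_sum A : total A = \sum_(v in A) total [set v]%SET.
Proof.
apply: EFin_inj; rewrite -sumEFin -total_onE.
under [RHS]eq_bigr do rewrite -total_onE.
rewrite -nneseries_sum => [|v k _]; last by rewrite lee_fin (weight_on_ge0 _ _ leg).
by apply: eq_eseriesr => k _; rewrite sumEFin -weight_on_sum.
Qed.

Lemma mass_update A : mass (update t m) A = mass t A + total A.
Proof.
rewrite /mass; under eq_bigr do rewrite ffunE.
by rewrite big_split /= total_sum.
Qed.

(** An infinite move can be shortened.  After a suitable number [K] of submoves,
    all edges whose raw load eventually exceeds 1 have done so, hence their
    vertices receive weight only through other edges.  A vertex that still grows
    therefore lies in an edge whose final raw load is at most 1, and
    [reach_between] applies from the cover after [K] submoves. *)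
Lemma reach_update : reach t (update t m).
Proof.
have partial_mono A : {homo partial m A : k l / (k <= l)%N >-> k <= l}.
  apply: homo_leq; [exact: lexx|exact: le_trans|move=> k].
  by rewrite partialS lerDl (weight_on_ge0 _ _ leg).
have after_le k A : mass (cover_after t m k) A <= mass (update t m) A.
  by rewrite mass_after mass_update lerD2l partial_le.
have [K over] : exists K, forall E, 1 < mass (update t m) E ->
    1 < mass (cover_after t m K) E.
  have /choice[K overK] E : exists k, 1 < mass (update t m) E ->
      1 < mass (cover_after t m k) E.
    have [le1|lt1] := leP (mass (update t m) E) 1; first by exists 0%N.
    have [|k lt_k] := @partial_lim E (1 - mass t E).
      by move: lt1; rewrite mass_update; lra.
    by exists k => _; rewrite mass_after; lra.
  exists (\max_E K E)%N => E /overK; rewrite !mass_after => /lt_le_trans; apply.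
  by rewrite lerD2l partial_mono // leq_bigmax.
apply: reach_trans (reach_after K leg) _; apply: reach_between => v.
  by rewrite -!mass_set1.
move=> lt_v; apply: contrapT => none; move: lt_v; apply/negP; rewrite -leNgt.
have {none}over_v E : E \in edges H -> v \in E -> 1 < mass (cover_after t m K) E.
  move=> EH vE; apply: over; rewrite ltNge; apply/negP => le1.
  by apply: none; exists E.
(* If all edges at v exceed 1 already after K submoves, v is never raised again. *)
have stuck d : partial m [set v]%SET (K + d) = partial m [set v]%SET K.
  elim: d => [|d IH]; rewrite ?addn0 // addnS partialS IH.
  rewrite /weight_on; case sub: (submove m _) => [[u w]|]; last by rewrite addr0.
  rewrite finset.in_set1; case: eqP => [uv|_]; last by rewrite addr0.
  have [/andP[]] := leg sub; rewrite le_eqVlt => /predU1P[<-|w0 _ _].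
    by rewrite addr0.
  have [E [EH uE]] := legal_edge leg sub w0.
  have := over_v E EH; rewrite -uv => /(_ uE); rewrite !mass_after.
  by have := partial_mono E _ _ (leq_addr d K); lra.
rewrite -!mass_set1 mass_update mass_after lerD2l leNgt; apply/negP.
move=> /partial_lim[k]; apply/negP; rewrite -leNgt.
have [/subnKC <-|/ltnW/partial_mono //] := leqP K k.
by rewrite stuck.
Qed.

End LegalMove.

(** Admissible moves and turns have the same effects on covers: this direction
    discards the order of the submoves, [turn_admissible] recovers a finite one. *)
Lemma admissible_turn t m : admissible H t m -> turn t (update t m).
Proof.
move=> [leg tot]; have tot1 : (total_on m [set: V]%SET <= 1)%E.
  by case: tot => [->|[]].
split; first exact: reach_update.
rewrite -!mass_size (mass_update leg tot1).
case: tot => [->|[_ fin]]; [by left|right; split=> //].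
by rewrite lerD2l -lee_fin -(total_onE leg tot1).
Qed.

Lemma total_fin (l : seq (V * R)) A : total_on (FinMove l) A =
  (partial (FinMove l) A (size l))%:E.
Proof.
apply/cvg_lim => //; apply: cvg_near_cst; exists (size l) => // n /= le_n.
rewrite (big_cat_nat _ le_n) //= big_mkord sumEFin.
rewrite [X in (_ + X)%E]big_nat_cond [X in (_ + X)%E]big1 ?adde0 //.
by move=> k /andP[/andP[le_k _] _]; rewrite /weight_on /= onth_default.
Qed.

Lemma weight_on_rcons (l : seq (V * R)) x A k : (k < size l)%N ->
  weight_on (FinMove (rcons l x)) A k = weight_on (FinMove l) A k.
Proof. by move=> lt_k; rewrite /weight_on /= -cats1 onth_cat lt_k. Qed.

Lemma partial_rcons (l : seq (V * R)) x A k : (k <= size l)%N ->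
  partial (FinMove (rcons l x)) A k = partial (FinMove l) A k.
Proof.
move=> le_k; apply: eq_bigr => i _; apply: weight_on_rcons.
exact: leq_trans (ltn_ord i) le_k.
Qed.

Lemma reach_legal t t' : (forall v, 0 <= t v) -> reach t t' ->
  exists2 l : seq (V * R), legal H t (FinMove l) &
    cover_after t (FinMove l) (size l) = t'.
Proof.
move=> t0; elim=> [|t1 u w E r [l leg end_l] w0 EH uE le1].
  by exists [::]; [move=> k u w /=; rewrite onth0n|exact: cover_after0].
have last_sub : submove (FinMove (rcons l (u, w))) (size l) = Some (u, w).
  by rewrite /= -cats1 onth_cat ltnn subnn.
have after_l : cover_after t (FinMove (rcons l (u, w))) (size l) = t1.
  by rewrite -end_l; apply/ffunP => v; rewrite !ffunE partial_rcons.
exists (rcons l (u, w)); last by rewrite size_rcons (cover_afterS _ last_sub) after_l.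
move=> k u' w' sub; have [lt_k|lt_k|eq_k] := ltngtP k (size l).
- have /leg[w01 [F [FH uF leF]]] : submove (FinMove l) k = Some (u', w').
    by rewrite -sub /= -cats1 onth_cat lt_k.
  split=> //; exists F; split=> //.
  by rewrite -/(partial (FinMove _) F k) partial_rcons // ltnW.
- by move: sub; rewrite /= onth_default // size_rcons.
move: sub; rewrite eq_k last_sub => -[<- <-].
have m0 : 0 <= mass t1 E.
  by apply: sumr_ge0 => v _; apply: le_trans (t0 v) (reach_ge r v).
split; first lra.
exists E; split=> //; move: le1; rewrite -after_l mass_after; apply: le_trans.
by rewrite !lerD2r ge_min lexx orbT.
Qed.

Lemma turn_admissible t t' : (forall v, 0 <= t v) -> turn t t' ->
  exists2 m, admissible H t m & update t m = t'.
Proof.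
move=> t0 [r size_t']; have [l leg end_l] := reach_legal t0 r.
have upd : update t (FinMove l) = t'.
  by rewrite -end_l; apply/ffunP => v; rewrite !ffunE total_fin.
exists (FinMove l) => //; split=> //; rewrite total_fin upd.
move: size_t'; rewrite -end_l -!mass_size mass_after => -[eq1|[le1 fin]].
  by left; congr EFin; lra.
by right; split=> //; rewrite lee_fin; lra.
Qed.

(** * Strategies and the winning predicate *)

Lemma position_rcons (h : @history R V) m :
  position (rcons h m) = update (position h) m.
Proof. by rewrite /position foldl_rcons. Qed.

Lemma to_move_rcons p (h : @history R V) m :
  to_move p (rcons h m) = opponent (to_move p h).
Proof. by rewrite /to_move size_rcons. Qed.

Lemma follows_rcons p sigma (h : @history R V) m : follows p sigma (rcons h m) <->
  follows p sigma h /\ (to_move p h = EdgeHitter -> m = sigma h).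
Proof.
split=> [fol|[fol last_m] h1 m1 h2].
  split=> [h1 m1 h2 hE|]; last by apply: (fol h m [::]); rewrite cats1.
  by apply: (fol h1 m1 (rcons h2 m)); rewrite hE rcons_cat.
case/lastP: h2 => [|h2 x].
  by rewrite cats1 => /rcons_inj[<- <-].
by rewrite -rcons_cons -rcons_cat => /rcons_inj[hE _]; exact: fol hE.
Qed.

Lemma position_range (h : @history R V) v : play H h -> 0 <= position h v <= 1.
Proof.
move=> pl; elim: pl v => [v|h' m _ IH _ adm v]; first by rewrite ffunE; lra.
by rewrite position_rcons; apply: reach_range IH (proj1 (admissible_turn adm)) v.
Qed.

(** Well-foundedness of turns allows an induction along the plays that follow
    [sigma], from their ends back to the start. *)
Lemma strategy_winning p sigma a :
  valid_strategy H p sigma -> ensures H p sigma a -> winning a p [ffun=> 0].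
Proof.
move=> valid ens.
suff win t : Acc continues t ->
    forall h, position h = t -> play H h -> follows p sigma h ->
    winning a (to_move p h) t.
  have acc0 : Acc continues [ffun=> 0].
    by apply: turn_wf => v; rewrite ffunE; lra.
  have fol0 : follows p sigma [::] by case.
  exact: win _ acc0 [::] erefl (play_start H) fol0.
elim=> {}t _ IH h posh; subst t => pl fol.
have [fin|nfin] := pselect (finished H (position h)).
  by apply: winning_finished => //; exact: ens.
case turn_p: (to_move p h).
  have adm := valid h pl fol nfin turn_p.
  apply: (winning_hitter nfin (admissible_turn adm)).
  rewrite -[Staller]/(opponent EdgeHitter) -turn_p -(to_move_rcons _ _ (sigma h)).
  apply: IH; [by split=> //; exact: admissible_turn|exact: position_rcons| |].
    exact: play_move.
  by apply/follows_rcons; split.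
apply: winning_staller => // t' trn.
have [|m adm upd] := turn_admissible _ trn.
  by move=> v; case/andP: (position_range v pl).
rewrite -[EdgeHitter]/(opponent Staller) -turn_p -(to_move_rcons _ _ m).
apply: IH => //; [by rewrite position_rcons|exact: play_move|].
by apply/follows_rcons; split; rewrite // turn_p.
Qed.

(** Choosing, at each history, a move to a winning position gives a strategy; it
    keeps every play that follows it inside the winning positions. *)
Lemma winning_strategy p a : winning a p [ffun=> 0] ->
  exists sigma, valid_strategy H p sigma /\ ensures H p sigma a.
Proof.
move=> win0.
have /choice[sigma sigmaP] (h : @history R V) : exists m,
    play H h -> ~ finished H (position h) -> winning a EdgeHitter (position h) ->
    admissible H (position h) m /\ winning a Staller (update (position h) m).
  have [pl|npl] := pselect (play H h); last by exists (FinMove [::]).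
  have [win|nwin] := pselect (winning a EdgeHitter (position h)); last first.
    by exists (FinMove [::]).
  have [fin|nfin] := pselect (finished H (position h)); first by exists (FinMove [::]).
  inversion win as [? ? fin|? t' _ trn win'|]; subst; first by [].
  have [|m adm upd] := turn_admissible _ trn.
    by move=> v; case/andP: (position_range v pl).
  by exists m => _ _ _; rewrite upd.
have keep h : play H h -> follows p sigma h -> winning a (to_move p h) (position h).
  elim=> // {}h m pl IH nfin adm /follows_rcons[/IH win last_m].
  rewrite position_rcons to_move_rcons.
  case turn_p: (to_move p h) win last_m => win last_m /=.
    by rewrite last_m //; case: (sigmaP h pl nfin win).
  inversion win as [? ? fin| |? _ win']; subst; first by [].
  exact/win'/admissible_turn.
exists sigma; split=> h pl fol.
  by move=> nfin turn_p; have := keep h pl fol; rewrite turn_p => /(sigmaP h pl nfin)[].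
by move=> fin; exact: winning_size (keep h pl fol).
Qed.

(** * The two game numbers *)

Lemma game_numberE p :
  game_number R H p = inf [set a | winning a p [ffun=> 0]]%classic.
Proof.
congr inf; apply/seteqP; split=> a /=; last exact: winning_strategy.
by move=> [sigma [valid ens]]; exact: strategy_winning valid ens.
Qed.

Lemma game_number_opponent p : game_number R H (opponent p) <= game_number R H p + 1.
Proof.
rewrite !game_numberE -lerBlDr; apply: lb_le_inf.
  by exists #|V|%:R; apply: winning_card => v; rewrite ffunE; lra.
move=> a /= /winning_opponent win; rewrite lerBlDr; apply: ge_inf => //.
exists 0 => b /= /winning_size; apply: le_trans.
by apply: sumr_ge0 => v _; rewrite ffunE.
Qed.

End FractionalGame.

Theorem theorem5 (R : realType) (V : finType) (H : hypergraph V) :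
  `|tau_g R H - tau_g' R H| <= 1.
Proof.
have := @game_number_opponent R V H EdgeHitter.
have := @game_number_opponent R V H Staller.
by rewrite /= /tau_g /tau_g' ler_norml; lra.
Qed.
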